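(* Let $N\ge 1$. For $i=1,\dots,N$ let $\Sigma_i$ be the discrete-time LTI system $$x_i^+ = A_i x_i + B_i u_i + G_i w_i,\quad y_i = C^{\mathrm{con}}_i x_i + D^{\mathrm{con}}_i u_i + H^{\mathrm{con}}_i w_i,\quad z_i = C^{\mathrm{opt}}_i x_i + D^{\mathrm{opt}}_i u_i + H^{\mathrm{opt}}_i w_i,$$ closed with the static nonlinear feedback $w_i=\varphi_i(z_i)$, and let these $N$ systems be coupled via $u=My$ for a real matrix $M$, where $u=[u_1^\top\ \cdots\ u_N^\top]^\top$ and $y=[y_1^\top\ \cdots\ y_N^\top]^\top$. Assume that the interconnection is well-posed and has a fixed point, and that: 1) each pair $(C_i^{\mathrm{opt}},A_i)$ is detectable; 2) for each $i$ there is a symmetric matrix $S_{\varphi_i}$ such that, with $$s_{\varphi_i}(\Delta z_i,\Delta w_i)=\begin{bmatrix}\Delta z_i\\ \Delta w_i\end{bmatrix}^\top S_{\varphi_i}\begin{bmatrix}\Delta z_i\\ \Delta w_i\end{bmatrix},$$ one has $s_{\varphi_i}(\Delta z_i,\Delta w_i)<0$ for all $\Delta z_i=z_i^1-z_i^2$ and corresponding $\Delta w_i=\varphi_i(z_i^1)-\varphi_i(z_i^2)$ with $(\Delta z_i,\Delta w_i)\neq(0,0)$. Suppose that for each $i$ there are a scalar $\alpha_i>0$ and matrices $Q_i=Q_i^\top$, $S_i$, $R_i=R_i^\top$ such that the LTI system $\Sigma_i$ (with inputs $u_i,w_i$ and outputs $y_i,z_i$) is incrementally dissipative, with dissipation rate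 $1$, with respect to the supply rate $$s_i(\Delta z_i,\Delta w_i,\Delta y_i,\Delta u_i)=\alpha_i s_{\varphi_i}(\Delta z_i,\Delta w_i)+\begin{bmatrix}\Delta y_i\\ \Delta u_i\end{bmatrix}^\top\begin{bmatrix}Q_i&S_i\\ S_i^\top&R_i\end{bmatrix}\begin{bmatrix}\Delta y_i\\ \Delta u_i\end{bmatrix},$$ and that, with the block diagonal matrices $Q=\operatorname{diag}(Q_1,\dots,Q_N)$, $S=\operatorname{diag}(S_1,\dots,S_N)$, $R=\operatorname{diag}(R_1,\dots,R_N)$, $$\begin{bmatrix}I\\ M\end{bmatrix}^\top\begin{bmatrix}Q&S\\ S^\top&R\end{bmatrix}\begin{bmatrix}I\\ M\end{bmatrix}\prec 0.$$ Then the interconnection, viewed as an autonomous system with state $x=[x_1^\top\ \cdots\ x_N^\top]^\top$, is nonexpansive, and every incremental trajectory satisfies $$\lim_{k\to\infty}\Delta x(k)=0.$$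
   Context: All signals are real and finite-dimensional, with matrices of compatible dimensions; $x^+$ and $x$ denote $x(k+1)$ and $x(k)$. The interconnection is well-posed: for every state $x$, the algebraic equations for $u,y,z,w$ (including $w_i=\varphi_i(z_i)$ and $u=My$) have a unique solution, so the interconnection is an autonomous discrete-time system in $x$. A fixed point is a state $x^*$ with $x^+=x^*$ whenever $x=x^*$. Incremental trajectory: the difference of two trajectories, e.g. $\Delta x=x^1-x^2$, and similarly $\Delta u,\Delta w,\Delta y,\Delta z$. Incremental dissipativity: a discrete-time system with state $x$, input $v$ and output $o$ is incrementally dissipative with respect to a supply rate $s$, with dissipation rate $\gamma\in(0,1]$, if there is a positive definite storage function $V$ such that $V(\Delta x^+)-\gamma V(\Delta x)\le s(\Delta o,\Delta v)$ for all incremental trajectories. Storage functions are taken to be positive definite quadratic, $V(\Delta x)=\Delta x^\top P\Delta x$ with $P\succ0$. For $\Sigma_i$ the input is $(u_i,w_i)$ (both free; the feedback $w_i=\varphi_i(z_i)$ is not imposed) and the output is $(y_i,z_i)$. Nonexpansiveness: an autonomous discrete-time system with state $x$ is nonexpansive if there is a positive definite quadratic function $V$ such that $V(\Delta x^+)-V(\Delta x)\le 0$ for every incremental trajectory $\Delta x\ne0$. Detectability of $(C,A)$ is in the discrete-time sense: every solution of $\xi^+=A\xi$ with $C\xi(k)=0$ for all $k$ converges to $0$. *)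

(* Defs.v *)
From HB Require Import structures.
From mathcomp Require Import all_boot all_order all_algebra.
From mathcomp Require Import all_classical all_reals all_analysis.

Set Implicit Arguments.
Unset Strict Implicit.
Unset Printing Implicit Defensive.

Import Order.TTheory GRing.Theory Num.Theory.
Import numFieldNormedType.Exports.

Local Open Scope classical_set_scope.
Local Open Scope ring_scope.

Section QuadraticForms.
Context {R : realType}.

Definition qform n (P : 'M[R]_n) (x : 'cV[R]_n) : R := (x^T *m P *m x) 0 0.

Definition posdefmx n (P : 'M[R]_n) : Prop :=
  P^T = P /\ forall x : 'cV[R]_n, x != 0 -> 0 < qform P x.

Definition negdefmx n (P : 'M[R]_n) : Prop :=
  P^T = P /\ forall x : 'cV[R]_n, x != 0 -> qform P x < 0.

(* Rectangular counterpart of [mxdiag], which only accepts square blocks; on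
   the diagonal [conform_mx] is just the cast needed to make it typecheck. *)
Definition mxdiag_rect N (p m : 'I_N -> nat)
    (B : forall i, 'M[R]_(p i, m i)) : 'M[R]_(\sum_i p i, \sum_i m i) :=
  \mxblock_(i, j) (if i == j then conform_mx 0 (B i) else 0).

End QuadraticForms.

Section Systems.
Context {R : realType}.

(* A system is given by the set of its trajectories: [traj x v o] for state
   [x], input [v] and output [o]. *)
Definition incrementally_dissipative n (V O : zmodType)
    (traj : (nat -> 'cV[R]_n) -> (nat -> V) -> (nat -> O) -> Prop)
    (s : O -> V -> R) (gamma : R) : Prop :=
  [/\ 0 < gamma, gamma <= 1 &
    exists2 P : 'M[R]_n, posdefmx P &
      forall x1 v1 o1 x2 v2 o2, traj x1 v1 o1 -> traj x2 v2 o2 ->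
      forall k, qform P (x1 k.+1 - x2 k.+1) - gamma * qform P (x1 k - x2 k)
                <= s (o1 k - o2 k) (v1 k - v2 k)].

(* An autonomous system is a one-step relation between [x(k)] and [x(k+1)]. *)
Definition trajectory n (step : 'cV[R]_n -> 'cV[R]_n -> Prop)
    (x : nat -> 'cV[R]_n) : Prop :=
  forall k, step (x k) (x k.+1).

Definition incremental_trajectory n (step : 'cV[R]_n -> 'cV[R]_n -> Prop)
    (dx : nat -> 'cV[R]_n) : Prop :=
  exists x1 x2, [/\ trajectory step x1, trajectory step x2 &
                    dx = (fun k => x1 k - x2 k)].

Definition fixed_point n (step : 'cV[R]_n -> 'cV[R]_n -> Prop)
    (xs : 'cV[R]_n) : Prop :=
  forall x', step xs x' <-> x' = xs.

(* [dx <> 0] is inequality of signals: [dx] is not identically zero. *)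
Definition nonexpansive n (step : 'cV[R]_n -> 'cV[R]_n -> Prop) : Prop :=
  exists2 P : 'M[R]_n, posdefmx P &
    forall dx, incremental_trajectory step dx -> dx <> (fun=> 0) ->
    forall k, qform P (dx k.+1) - qform P (dx k) <= 0.

Definition detectable n q (C : 'M[R]_(q, n)) (A : 'M[R]_n) : Prop :=
  forall xi : nat -> 'cV[R]_n,
    (forall k, xi k.+1 = A *m xi k) -> (forall k, C *m xi k = 0) ->
    xi @ \oo --> (0 : 'cV[R]_n).

(* Dimensions: [n] state x, [m] input u, [r] input w, [p] output y,
   [q] output z. *)
Record lti (n m r p q : nat) := LTI {
  mxA : 'M[R]_n;
  mxB : 'M[R]_(n, m);
  mxG : 'M[R]_(n, r);
  mxCcon : 'M[R]_(p, n);
  mxDcon : 'M[R]_(p, m);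
  mxHcon : 'M[R]_(p, r);
  mxCopt : 'M[R]_(q, n);
  mxDopt : 'M[R]_(q, m);
  mxHopt : 'M[R]_(q, r)
}.

Section LTI.
Variables (n m r p q : nat) (Sigma : lti n m r p q).

Definition lti_next (x : 'cV[R]_n) (u : 'cV[R]_m) (w : 'cV[R]_r) : 'cV[R]_n :=
  mxA Sigma *m x + mxB Sigma *m u + mxG Sigma *m w.

Definition lti_y (x : 'cV[R]_n) (u : 'cV[R]_m) (w : 'cV[R]_r) : 'cV[R]_p :=
  mxCcon Sigma *m x + mxDcon Sigma *m u + mxHcon Sigma *m w.

Definition lti_z (x : 'cV[R]_n) (u : 'cV[R]_m) (w : 'cV[R]_r) : 'cV[R]_q :=
  mxCopt Sigma *m x + mxDopt Sigma *m u + mxHopt Sigma *m w.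

(* Input [v = (u, w)], both components free, and output [o = (y, z)]. *)
Definition lti_trajectory (x : nat -> 'cV[R]_n)
    (v : nat -> 'cV[R]_m * 'cV[R]_r) (o : nat -> 'cV[R]_p * 'cV[R]_q) : Prop :=
  forall k, [/\ x k.+1 = lti_next (x k) (v k).1 (v k).2,
                (o k).1 = lti_y (x k) (v k).1 (v k).2 &
                (o k).2 = lti_z (x k) (v k).1 (v k).2].

End LTI.

Definition supply_phi q r (Sphi : 'M[R]_(q + r))
    (dz : 'cV[R]_q) (dw : 'cV[R]_r) : R :=
  qform Sphi (col_mx dz dw).

Definition supply m r p q (alpha : R) (Sphi : 'M[R]_(q + r))
    (Q : 'M[R]_p) (S : 'M[R]_(p, m)) (T : 'M[R]_m)
    (o : 'cV[R]_p * 'cV[R]_q) (v : 'cV[R]_m * 'cV[R]_r) : R :=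
  let: (dy, dz) := o in let: (du, dw) := v in
  alpha * supply_phi Sphi dz dw +
  qform (block_mx Q S S^T T) (col_mx dy du).

Section Interconnection.
Variables (N : nat) (n m r p q : 'I_N -> nat).
Variable Sigma : forall i, lti (n i) (m i) (r i) (p i) (q i).
Variable phi : forall i, 'cV[R]_(q i) -> 'cV[R]_(r i).
Variable M : 'M[R]_(\sum_i m i, \sum_i p i).

Definition loop_equations (x : 'cV[R]_(\sum_i n i))
    (s : 'cV[R]_(\sum_i m i) * 'cV[R]_(\sum_i p i) *
         'cV[R]_(\sum_i q i) * 'cV[R]_(\sum_i r i)) : Prop :=
  let: (u, y, z, w) := s in
  [/\ forall i, submxcol y i =
        lti_y (Sigma i) (submxcol x i) (submxcol u i) (submxcol w i),
      forall i, submxcol z i =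
        lti_z (Sigma i) (submxcol x i) (submxcol u i) (submxcol w i),
      forall i, submxcol w i = phi (submxcol z i) &
      u = M *m y].

Definition well_posed : Prop := forall x, exists! s, loop_equations x s.

Definition interconnection (x x' : 'cV[R]_(\sum_i n i)) : Prop :=
  exists u y z w, loop_equations x (u, y, z, w) /\
    forall i, submxcol x' i =
      lti_next (Sigma i) (submxcol x i) (submxcol u i) (submxcol w i).

End Interconnection.
End Systems.

Arguments lti R n m r p q : clear implicits.

(* Main.v *)
(* Summing the dissipation inequalities with storage V = sum_i V_i bounds the
   increment of V along two closed-loop steps by the supplies of the
   nonlinearities plus the quadratic form of the matrix inequality at dy, all
   nonpositive. So the one-step map is nonexpansive for the norm sqrt V, hence
   continuous although phi need not be. Orbits are bounded because of the fixed
   point xs, and LaSalle's argument applies: on the orbit of a cluster point,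
   V (x - xs) is constant, so the strict inequalities force dz = dw = 0, dy = 0
   and du = M dy = 0; each block then evolves by A_i with C_i^opt dx_i = 0 and
   tends to 0 by detectability. The constant is therefore 0, and every orbit
   converges to xs. *)

Require Import Defs.
From HB Require Import structures.
From mathcomp Require Import all_boot all_order all_algebra.
From mathcomp Require Import all_classical all_reals all_analysis.
Import Order.TTheory GRing.Theory Num.Theory.
Import numFieldNormedType.Exports.
Local Open Scope classical_set_scope.
Local Open Scope ring_scope.

Set Implicit Arguments.
Unset Strict Implicit.

(** * Norm, transposition and compactness for column vectors *)

Lemma mx_norm_leP (R : realType) m n (A : 'M[R]_(m, n)) (e : R) : 0 <= e ->
  reflect (forall i j, `|A i j| <= e) (`|A| <= e).
Proof.
move=> e0; rewrite /Num.norm /= mx_normrE; apply: (iffP (bigmax_leP _ _ _ _)).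
  by move=> [_ h] i j; exact: (h (i, j)).
by move=> h; split => // -[i j] _; exact: h.
Qed.

Lemma norm_trmx (R : realType) m n (A : 'M[R]_(m, n)) : `|A^T| = `|A|.
Proof.
suff le_tr p q (B : 'M[R]_(p, q)) : `|B^T| <= `|B|.
  by apply/le_anti; rewrite le_tr -{1}[A]trmxK le_tr.
apply/mx_norm_leP => // i j; rewrite mxE.
by have /mx_norm_leP := lexx `|B|; apply.
Qed.

Lemma continuous_trmx (R : realType) m n : continuous (@trmx R m n).
Proof.
(* A basic neighbourhood of a matrix is a family of neighbourhoods of its entries; transposing the
   family around [A^T] gives one around [A]. *)
move=> A U [P nbhsP sPU]; exists (fun j i => P i j) => [j i|B PB].
  by have := nbhsP i j; rewrite mxE.
by apply: sPU => i j; rewrite mxE; exact: PB.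
Qed.

(** Heine-Borel carried over from row vectors: transposition is continuous and preserves the norm,
    and [A] is the image of its own preimage under it. *)
Lemma bounded_closed_compact_cV (R : realType) n (A : set 'cV[R]_n) :
  bounded_set A -> closed A -> compact A.
Proof.
move=> [M [Mreal normAltM]] Acl.
have -> : A = @trmx R 1 n @` (@trmx R 1 n @^-1` A).
  apply/seteqP; split => [x Ax|_ [y Ay <-] //].
  by exists x^T; rewrite /= trmxK.
apply: continuous_compact.
  by apply: continuous_subspaceT => x; exact: continuous_trmx.
apply: bounded_closed_compact.
  by exists M; split => // x Mx y /= Ay; rewrite -norm_trmx; exact: normAltM.
by apply: closed_comp => // x _; exact: continuous_trmx.
Qed.

(** * Quadratic forms: continuity, homogeneity, coercivity *)

Lemma qformE (R : realType) n (P : 'M[R]_n) (x : 'cV[R]_n) :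
  qform P x = \sum_i \sum_j x j 0 * P j i * x i 0.
Proof.
rewrite /qform mxE; apply: eq_bigr => i _; rewrite mxE mulr_suml.
by apply: eq_bigr => j _; rewrite mxE.
Qed.

Lemma continuous_qform (R : realType) n (P : 'M[R]_n) : continuous (qform P).
Proof.
rewrite (funext (qformE P)).
apply: continuous_big => [|i _]; first exact: add_continuous.
apply: continuous_big => [|j _ x]; first exact: add_continuous.
have coordc k : {for x, continuous (fun y : 'cV[R]_n => y k 0)}.
  exact: coord_continuous.
apply: (continuousM _ (coordc i)).
by apply: (continuousM (coordc j)); exact: cst_continuous.
Qed.

Lemma qformZ (R : realType) n (P : 'M[R]_n) a (x : 'cV[R]_n) :
  qform P (a *: x) = a ^+ 2 * qform P x.
Proof. by rewrite /qform linearZ /= linearZ /= -!scalemxAl scalerA mxE. Qed.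

Lemma qform0 (R : realType) n (P : 'M[R]_n) : qform P 0 = 0.
Proof. by rewrite /qform mulmx0 mxE. Qed.

Lemma posdef_ge0 (R : realType) n (P : 'M[R]_n) x :
  posdefmx P -> 0 <= qform P x.
Proof.
by move=> [_ P0]; have [->|/P0/ltW//] := eqVneq x 0; rewrite qform0.
Qed.

Lemma posdef_le0_eq0 (R : realType) n (P : 'M[R]_n) x :
  posdefmx P -> qform P x <= 0 -> x = 0.
Proof.
by move=> [_ P0] x0; have [//|/P0] := eqVneq x 0; rewrite ltNge x0.
Qed.

(** The constant is the minimum of the form on the unit sphere, attained by compactness and positive
    since the minimiser is nonzero; homogeneity extends the bound to all vectors. *)
Lemma posdef_coercive (R : realType) n (P : 'M[R]_n) : posdefmx P ->
  exists2 c : R, 0 < c & forall x, c * `|x| ^+ 2 <= qform P x.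
Proof.
move=> Ppos; have [_ P0] := Ppos.
pose S := [set x : 'cV[R]_n | `|x| = 1].
(* An empty sphere means that zero is the only vector, since any other could be normalised; any
   constant then works. *)
have [S0|S0] := eqVneq S set0.
  exists 1 => // x; suff -> : x = 0 by rewrite normr0 expr0n /= mulr0 qform0.
  apply/eqP/negPn/negP => x0; suff : S (`|x|^-1 *: x) by rewrite S0.
  by rewrite /S /= normrZ normfV normr_id mulVf // normr_eq0.
have cS : compact S.
  apply: bounded_closed_compact_cV.
    by exists 1; split => // M M1 x /= ->; exact: ltW.
  rewrite (_ : S = Num.norm @^-1` [set 1 : R]) //.
  apply: closed_comp; first by move=> x _; exact: norm_continuous.
  exact: closed_eq.
have [] := compact_EVT_min (f := qform P) _ cS.
- exact/set0P.
- by apply: continuous_subspaceT => x; exact: continuous_qform.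
move=> v; rewrite inE => Sv vmin; exists (qform P v).
  apply: P0; apply/eqP => v0; move: Sv; rewrite /S /= v0 normr0.
  by move/eqP; rewrite eq_sym oner_eq0.
move=> x; have [->|x0] := eqVneq x 0.
  by rewrite normr0 expr0n /= mulr0 qform0.
have nx0 : `|x| != 0 by rewrite normr_eq0.
rewrite -ler_pdivlMr ?exprn_gt0 ?normr_gt0 // mulrC -exprVn -qformZ.
by apply: vmin; rewrite inE /S /= normrZ normfV normr_id mulVf.
Qed.

Lemma posdef_cvg0 (R : realType) n (P : 'M[R]_n) T (F : set_system T)
    (FF : Filter F) (x : T -> 'cV[R]_n) : posdefmx P ->
  qform P (x t) @[t --> F] --> (0 : R) -> x t @[t --> F] --> (0 : 'cV[R]_n).
Proof.
move=> /posdef_coercive [c c0 cP] Px; apply/cvgr0Pnorm_lt => e e0.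
have ce0 : 0 < c * e ^+ 2 by rewrite mulr_gt0 ?exprn_gt0.
near=> t; rewrite -(@ltr_pXn2r _ 2) ?nnegrE ?(ltW e0) //.
rewrite -(ltr_pM2l c0); apply: le_lt_trans (cP _) _.
apply: le_lt_trans (ler_norm _) _; near: t.
exact: cvgr0_norm_lt.
Unshelve. all: by end_near. Qed.

(** * Maps nonexpansive for a quadratic norm, and LaSalle's argument *)

Lemma nonexpansive_cvg (R : realType) n (P : 'M[R]_n)
    (f : 'cV[R]_n -> 'cV[R]_n) T (F : set_system T) (FF : Filter F)
    (y : T -> 'cV[R]_n) x : posdefmx P ->
  (forall x y, qform P (f x - f y) <= qform P (x - y)) ->
  y t @[t --> F] --> x -> f (y t) @[t --> F] --> f x.
Proof.
move=> Ppos f_le yx; apply/subr_cvg0; apply: (posdef_cvg0 _ Ppos).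
apply: (@squeeze_cvgr _ _ _ _ (fun=> 0) (fun t => qform P (y t - x))).
- by near=> t; rewrite posdef_ge0 //= f_le.
- exact: cvg_cst.
rewrite -(qform0 P); apply: continuous_cvg; first exact: continuous_qform.
exact/subr_cvg0.
Unshelve. all: by end_near. Qed.

(** The last hypothesis is the invariance condition: no orbit other than that of [xs] keeps a
    constant distance to [xs]. It is applied to a cluster point of the orbit. This identifies the
    cluster point with [xs], so the decreasing distance has limit 0 and the whole orbit
    converges. *)
Lemma lasalle_qform (R : realType) n (P : 'M[R]_n) (f : 'cV[R]_n -> 'cV[R]_n)
    (xs : 'cV[R]_n) : posdefmx P ->
  (forall x y, qform P (f x - f y) <= qform P (x - y)) -> f xs = xs ->
  (forall x, (forall k, qform P (iter k f x - xs) = qform P (x - xs)) ->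
    x = xs) ->
  forall x, iter k f x @[k --> \oo] --> xs.
Proof.
move=> Ppos f_le fxs inv x.
have fcont : continuous f.
  move=> y.
  exact: (nonexpansive_cvg (nbhs_filter y) Ppos f_le (@cvg_id _ (nbhs y))).
pose V y := qform P (y - xs).
have Vcont : continuous V.
  move=> y.
  apply: (@continuous_comp 'cV[R]_n 'cV[R]_n R (fun z => z - xs) (qform P) y).
    by apply: continuousB; [exact: cvg_id|exact: cst_continuous].
  exact: continuous_qform.
have Vdec : nonincreasing_seq (fun k => V (iter k f x)).
  by apply/nonincreasing_seqP => k; rewrite /V iterS -{1}fxs f_le.
have Vcvg : cvgn (fun k => V (iter k f x)).
  apply: nonincreasing_is_cvgn => //.
  by exists 0 => _ [k _ <-]; exact: posdef_ge0.
set c := limn (fun k => V (iter k f x)) in Vcvg.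
have [y ycl] : exists y, cluster (iter k f x @[k --> \oo]) y.
  pose K := [set y | V y <= V x].
  have cK : compact K.
    apply: bounded_closed_compact_cV; last first.
      rewrite (_ : K = V @^-1` [set t | t <= V x]) //.
      by apply: closed_comp; [move=> ? _; exact: Vcont|exact: closed_le].
    have [l l0 lP] := posdef_coercive Ppos.
    (* The radius comes from [l * |y - xs|^2 <= V y <= V x] and the triangle inequality. *)
    exists (Num.sqrt (V x / l) + `|xs|); split; first exact: num_real.
    move=> M ltM y /= Ky; apply: le_trans (ltW ltM).
    rewrite -[y](subrK xs); apply: le_trans (ler_normD _ _) _.
    rewrite lerD2r -[leLHS]ger0_norm // -sqrtr_sqr ler_wsqrtr //.
    by rewrite ler_pdivlMr // mulrC (le_trans (lP _)).
  have [|y [_ ycl]] := cK (iter k f x @[k --> \oo]) _; last by exists y.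
  by exists 0%N => //= k _; rewrite /K /= -[x in leRHS]/(iter 0 f x) Vdec.
(* Along the orbit, the values of [V] after [j] further steps tend to [c], being a shift of a
   sequence with that limit. By continuity they also cluster at [V (iter j f y)], so the two numbers
   differ by at most any positive [e]. *)
have Viter j : V (iter j f y) = c.
  have gcont : continuous (fun z => V (iter j f z)).
    move=> z; apply: continuous_comp; last exact: Vcont.
    elim: j {ycl} z => [|j IH] z /=; first exact: cvg_id.
    by apply: (@continuous_comp _ _ _ (iter j f) f); [exact: IH|exact: fcont].
  apply/eqP; rewrite -subr_eq0 -normr_le0; apply/ler_addgt0Pl => e e0.
  have e2 : 0 < e / 2 by rewrite divr_gt0.
  have Ve : (iter k f x @[k --> \oo]) [set z | `|c - V (iter j f z)| < e / 2].
    have : V (iter (k + j) f x) @[k --> \oo] --> c.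
      by rewrite (cvg_shiftn j (fun k => V (iter k f x))); exact: Vcvg.
    move=> /cvgr_dist_lt /(_ _ e2); apply: filterS => k /=.
    by rewrite addnC iterD.
  have We : nbhs y [set z | `|V (iter j f y) - V (iter j f z)| < e / 2].
    exact: cvgr_dist_lt (gcont y) _ e2.
  have [z /= [Vz Wz]] := ycl _ _ Ve We.
  rewrite addr0 [e]splitr -(subrK (V (iter j f z)) (V (iter j f y))) -addrA.
  by rewrite (le_trans (ler_normD _ _)) // lerD ?(ltW Wz) // distrC ltW.
have yxs : y = xs by apply: inv => k; rewrite -!/(V _) Viter -(Viter 0%N).
have c0 : c = 0 by rewrite -(Viter 0%N) /= yxs /V subrr qform0.
apply/subr_cvg0; apply: (posdef_cvg0 _ Ppos).
by rewrite -c0; exact: Vcvg.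
Qed.

(** * Block-diagonal quadratic forms as sums over the subsystems *)

Lemma qform_mxdiag (R : realType) N (n : 'I_N -> nat)
    (P : forall i, 'M[R]_(n i)) (x : 'cV[R]_(\sum_i n i)) :
  qform (\mxdiag_i P i) x = \sum_i qform (P i) (submxcol x i).
Proof.
rewrite /qform -{1 2}[x]submxcolK tr_mxcol mul_mxrow_mxdiag mul_mxrow_mxcol.
by rewrite summxE.
Qed.

Lemma posdefmx_mxdiag (R : realType) N (n : 'I_N -> nat)
    (P : forall i, 'M[R]_(n i)) :
  (forall i, posdefmx (P i)) -> posdefmx (\mxdiag_i P i).
Proof.
move=> Ppos; split.
  by rewrite tr_mxdiag; apply: eq_mxdiag => i; have [] := Ppos i.
move=> x x0; rewrite lt_neqAle eq_sym qform_mxdiag sumr_ge0 ?andbT; last first.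
  by move=> i _; exact: posdef_ge0.
apply: contra x0 => /eqP/psumr_eq0P V0; apply/eqP/mxcolP => i.
rewrite submxcol0; apply: posdef_le0_eq0 (Ppos i) _.
by rewrite V0 // => j _; exact: posdef_ge0.
Qed.

Lemma mulmx_mxdiag_rect (R : realType) N (p m : 'I_N -> nat)
    (S : forall i, 'M[R]_(p i, m i)) (x : 'cV[R]_(\sum_i p i))
    (y : 'cV[R]_(\sum_i m i)) :
  x^T *m mxdiag_rect S *m y =
  \sum_i (submxcol x i)^T *m S i *m submxcol y i.
Proof.
rewrite -{1}[x]submxcolK -{1}[y]submxcolK tr_mxcol -mulmxA.
rewrite mul_mxblock_mxrow mul_mxrow_mxcol; apply: eq_bigr => i _.
(* Only the diagonal block survives in row [i], and there the cast is the identity. *)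
rewrite (bigD1 i) //= eqxx conform_mx_id big1 ?addr0 ?mulmxA // => j ji.
by rewrite eq_sym (negPf ji) mul0mx.
Qed.

Lemma qform_block_mx (R : realType) p m (Q : 'M[R]_p) (S : 'M[R]_(p, m))
    (T : 'M[R]_m) (x : 'cV[R]_p) (y : 'cV[R]_m) :
  qform (block_mx Q S S^T T) (col_mx x y) =
  qform Q x + (x^T *m S *m y) 0 0 *+ 2 + qform T y.
Proof.
(* The two cross terms are transposes of each other, hence equal as 1 by 1 matrices. *)
have trS : y^T *m S^T *m x = (x^T *m S *m y)^T.
  by rewrite !trmx_mul trmxK mulmxA.
rewrite /qform tr_col_mx mul_row_block mul_row_col !mulmxDl trS.
have addE (A B : 'M[R]_1) : (A + B) 0 0 = A 0 0 + B 0 0 by rewrite mxE.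
have trE (A : 'M[R]_1) : A^T 0 0 = A 0 0 by rewrite mxE.
by rewrite !addE trE mulr2n !addrA.
Qed.

Lemma qform_block_mxdiag (R : realType) N (p m : 'I_N -> nat)
    (Q : forall i, 'M[R]_(p i)) (S : forall i, 'M[R]_(p i, m i))
    (T : forall i, 'M[R]_(m i)) x y :
  qform (block_mx (\mxdiag_i Q i) (mxdiag_rect S) (mxdiag_rect S)^T
           (\mxdiag_i T i)) (col_mx x y) =
  \sum_i qform (block_mx (Q i) (S i) (S i)^T (T i))
           (col_mx (submxcol x i) (submxcol y i)).
Proof.
rewrite qform_block_mx !qform_mxdiag mulmx_mxdiag_rect summxE -sumrMnl.
by rewrite -!big_split; apply: eq_bigr => i _; rewrite qform_block_mx.
Qed.

Lemma qform_congr (R : realType) m n (P : 'M[R]_m) (L : 'M[R]_(m, n)) x :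
  qform (L^T *m P *m L) x = qform P (L *m x).
Proof. by rewrite /qform trmx_mul !mulmxA. Qed.

(** * Incremental behaviour of one linear subsystem *)

Section LTIDifferences.
Variables (R : realType) (n m r p q : nat) (Sigma : lti R n m r p q).

Let combB k (A : 'M[R]_(k, n)) (B : 'M[R]_(k, m)) (C : 'M[R]_(k, r))
    x1 u1 w1 x2 u2 w2 :
  A *m (x1 - x2) + B *m (u1 - u2) + C *m (w1 - w2) =
  A *m x1 + B *m u1 + C *m w1 - (A *m x2 + B *m u2 + C *m w2) :> 'cV_k.
Proof.
by rewrite !mulmxBr (addrACA (A *m x1)) (addrACA (A *m x1 + _)) -!opprD.
Qed.

Lemma lti_nextB x1 u1 w1 x2 u2 w2 :
  lti_next Sigma (x1 - x2) (u1 - u2) (w1 - w2) =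
  lti_next Sigma x1 u1 w1 - lti_next Sigma x2 u2 w2.
Proof. exact: combB. Qed.

Lemma lti_yB x1 u1 w1 x2 u2 w2 :
  lti_y Sigma (x1 - x2) (u1 - u2) (w1 - w2) =
  lti_y Sigma x1 u1 w1 - lti_y Sigma x2 u2 w2.
Proof. exact: combB. Qed.

Lemma lti_zB x1 u1 w1 x2 u2 w2 :
  lti_z Sigma (x1 - x2) (u1 - u2) (w1 - w2) =
  lti_z Sigma x1 u1 w1 - lti_z Sigma x2 u2 w2.
Proof. exact: combB. Qed.

(** By linearity every triple [(x, u, w)] is an increment: it is the difference at time 0 between
    the trajectory from [x] with constant inputs [u], [w] and the one from 0 with zero inputs. The
    trajectory inequality thus becomes a pointwise one. *)
Lemma lti_dissipation_ineq s :
  incrementally_dissipative (lti_trajectory Sigma) s 1 ->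
  exists2 P : 'M[R]_n, posdefmx P & forall x u w,
    qform P (lti_next Sigma x u w) - qform P x <=
    s (lti_y Sigma x u w, lti_z Sigma x u w) (u, w).
Proof.
move=> [_ _ [P Ppos dissP]]; exists P => // x u w.
pose X u w x := fun k => iter k (fun x => lti_next Sigma x u w) x.
have trajX x0 u0 w0 : lti_trajectory Sigma (X u0 w0 x0) (fun=> (u0, w0))
    (fun k => (lti_y Sigma (X u0 w0 x0 k) u0 w0,
               lti_z Sigma (X u0 w0 x0 k) u0 w0)) by [].
have := dissP _ _ _ _ _ _ (trajX x u w) (trajX 0 0 0) 0%N.
have pairB (U W : zmodType) (a b : U) (c d : W) :
  (a, c) - (b, d) = (a - b, c - d) by [].
by rewrite /X /= -lti_nextB mul1r !pairB -lti_yB -lti_zB !subr0.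
Qed.

End LTIDifferences.

(** * Dissipation inequality of the interconnection and its equality case *)

Lemma sumr_le0_eq0 (R : realType) (I : finType) (F : I -> R) :
  (forall i, F i <= 0) -> 0 <= \sum_i F i -> forall i, F i = 0.
Proof.
move=> F0 sum0 i; apply/oppr_inj; rewrite oppr0.
apply: (@psumr_eq0P R I predT (fun i => - F i)) => // [j _|].
  by rewrite oppr_ge0.
by apply/le_anti; rewrite sumrN oppr_le0 sum0 -sumrN sumr_ge0 // => j _;
  rewrite oppr_ge0.
Qed.

(** The storage increment is bounded by a sum of nonpositive terms; if it vanishes, so does each
    term, and strictness kills every signal driving the blocks. The two steps are arbitrary, so that
    taking [x1 = x2] also yields uniqueness of the successor state. *)
Lemma interconnection_dissipation (R : realType) (N : nat)
    (n m r p q : 'I_N -> nat)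
    (Sigma : forall i, lti R (n i) (m i) (r i) (p i) (q i))
    (phi : forall i, 'cV[R]_(q i) -> 'cV[R]_(r i))
    (M : 'M[R]_(\sum_i m i, \sum_i p i))
    (Sphi : forall i, 'M[R]_(q i + r i))
    (alpha : 'I_N -> R) (Qm : forall i, 'M[R]_(p i))
    (Sm : forall i, 'M[R]_(p i, m i)) (Rm : forall i, 'M[R]_(m i))
    (P : forall i, 'M[R]_(n i)) (x1 x1' x2 x2' : 'cV[R]_(\sum_i n i)) :
  (forall i (z1 z2 : 'cV[R]_(q i)),
     (z1 - z2, phi i z1 - phi i z2) <> (0, 0) ->
     supply_phi (Sphi i) (z1 - z2) (phi i z1 - phi i z2) < 0) ->
  (forall i, 0 < alpha i) ->
  (forall i x u w,
     qform (P i) (lti_next (Sigma i) x u w) - qform (P i) x <=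
     supply (alpha i) (Sphi i) (Qm i) (Sm i) (Rm i)
       (lti_y (Sigma i) x u w, lti_z (Sigma i) x u w) (u, w)) ->
  negdefmx
     ((col_mx 1%:M M)^T *m
      block_mx (\mxdiag_i Qm i) (mxdiag_rect Sm)
               (mxdiag_rect Sm)^T (\mxdiag_i Rm i) *m
      col_mx 1%:M M) ->
  interconnection Sigma phi M x1 x1' -> interconnection Sigma phi M x2 x2' ->
  qform (\mxdiag_i P i) (x1' - x2') <= qform (\mxdiag_i P i) (x1 - x2) /\
  (qform (\mxdiag_i P i) (x1' - x2') = qform (\mxdiag_i P i) (x1 - x2) ->
   forall i,
     submxcol (x1' - x2') i = mxA (Sigma i) *m submxcol (x1 - x2) i /\
     mxCopt (Sigma i) *m submxcol (x1 - x2) i = 0).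
Proof.
move=> HSphi Halpha HP [_ LMI0].
move=> [u1 [y1 [z1 [w1 [[Hy1 Hz1 Hw1 Hu1] Hx1]]]]].
move=> [u2 [y2 [z2 [w2 [[Hy2 Hz2 Hw2 Hu2] Hx2]]]]].
set L := (_^T *m _ *m _) in LMI0.
set dx := x1 - x2; set dx' := x1' - x2'.
set du := u1 - u2; set dy := y1 - y2; set dz := z1 - z2; set dw := w1 - w2.
have duE : du = M *m dy by rewrite /du Hu1 Hu2 mulmxBr.
have nextE i : submxcol dx' i =
    lti_next (Sigma i) (submxcol dx i) (submxcol du i) (submxcol dw i).
  by rewrite !submxcolB lti_nextB Hx1 Hx2.
have yE i : submxcol dy i =
    lti_y (Sigma i) (submxcol dx i) (submxcol du i) (submxcol dw i).
  by rewrite !submxcolB lti_yB Hy1 Hy2.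
have zE i : submxcol dz i =
    lti_z (Sigma i) (submxcol dx i) (submxcol du i) (submxcol dw i).
  by rewrite !submxcolB lti_zB Hz1 Hz2.
pose s i := supply_phi (Sphi i) (submxcol dz i) (submxcol dw i).
have s_lt0 i : (submxcol dz i, submxcol dw i) <> (0, 0) -> s i < 0.
  by rewrite /s !submxcolB Hw1 Hw2; exact: HSphi.
have s_le0 i : s i <= 0.
  have [[z0 w0]|/s_lt0/ltW//] :=
    pselect ((submxcol dz i, submxcol dw i) = (0, 0)).
  by rewrite /s z0 w0 /supply_phi col_mx0 qform0.
have as_le0 i : alpha i * s i <= 0 by rewrite pmulr_rle0.
have L_le0 : qform L dy <= 0.
  by have [->|/LMI0/ltW//] := eqVneq dy 0; rewrite qform0.
have sum_le0 : \sum_i alpha i * s i <= 0 by exact: sumr_le0.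
have diss : qform (\mxdiag_i P i) dx' - qform (\mxdiag_i P i) dx <=
    \sum_i alpha i * s i + qform L dy.
  (* The congruence evaluates the block form at [(dy, M dy) = (dy, du)], which splits into the
     coupling supplies of the subsystems. *)
  rewrite /L qform_congr mul_col_mx mul1mx -duE qform_block_mxdiag.
  rewrite !qform_mxdiag -sumrB -big_split; apply: ler_sum => i _ /=.
  by rewrite nextE (le_trans (HP _ _ _ _)) // /supply -yE -zE.
split=> [|Veq i].
  by rewrite -subr_le0 (le_trans diss) // -[leRHS]addr0 lerD.
rewrite Veq subrr in diss.
have dy0 : dy = 0.
  have [//|/LMI0 L0] := eqVneq dy 0.
  by have := ler_ltD sum_le0 L0; rewrite addr0 ltNge diss.
have du0 : du = 0 by rewrite duE dy0 mulmx0.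
have s0 : s i = 0.
  have as0 : alpha i * s i = 0.
    apply: sumr_le0_eq0 as_le0 _ i.
    by rewrite (le_trans diss) // -[leRHS]addr0 lerD.
  by move/eqP: as0; rewrite mulf_eq0 gt_eqF //= => /eqP.
have [z0 w0] : (submxcol dz i, submxcol dw i) = (0, 0).
  by apply: contrapT => /s_lt0; rewrite s0 ltxx.
(* With zero [du], [dz] and [dw], the output equation reduces to [0 = C dx] and the state equation
   to [dx' = A dx]. *)
have := zE i; rewrite z0 nextE w0 du0 submxcol0 /lti_next /lti_z.
by rewrite !mulmx0 !addr0 => <-.
Qed.

(** * Nonexpansiveness and convergence of the interconnection *)

Theorem theorem2 (R : realType) (N : nat) (hN : (1 <= N)%N)
  (n m r p q : 'I_N -> nat)
  (Sigma : forall i, lti R (n i) (m i) (r i) (p i) (q i))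
  (phi : forall i, 'cV[R]_(q i) -> 'cV[R]_(r i))
  (M : 'M[R]_(\sum_i m i, \sum_i p i))
  (Hwp : well_posed Sigma phi M)
  (Hfix : exists xs, fixed_point (interconnection Sigma phi M) xs)
  (Hdet : forall i, detectable (mxCopt (Sigma i)) (mxA (Sigma i)))
  (Sphi : forall i, 'M[R]_(q i + r i))
  (HSphi_sym : forall i, (Sphi i)^T = Sphi i)
  (HSphi : forall i (z1 z2 : 'cV[R]_(q i)),
     (z1 - z2, phi i z1 - phi i z2) <> (0, 0) ->
     supply_phi (Sphi i) (z1 - z2) (phi i z1 - phi i z2) < 0)
  (alpha : 'I_N -> R) (Halpha : forall i, 0 < alpha i)
  (Qm : forall i, 'M[R]_(p i)) (HQ : forall i, (Qm i)^T = Qm i)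
  (Sm : forall i, 'M[R]_(p i, m i))
  (Rm : forall i, 'M[R]_(m i)) (HR : forall i, (Rm i)^T = Rm i)
  (Hdiss : forall i, incrementally_dissipative (lti_trajectory (Sigma i))
     (supply (alpha i) (Sphi i) (Qm i) (Sm i) (Rm i)) 1)
  (HLMI : negdefmx
     ((col_mx 1%:M M)^T *m
      block_mx (\mxdiag_i Qm i) (mxdiag_rect Sm)
               (mxdiag_rect Sm)^T (\mxdiag_i Rm i) *m
      col_mx 1%:M M)) :
  nonexpansive (interconnection Sigma phi M) /\
  forall dx, incremental_trajectory (interconnection Sigma phi M) dx ->
    dx k @[k --> \oo] --> (0 : 'cV[R]_(\sum_i n i)).
Proof.
pose PH i := cid2 (lti_dissipation_ineq (Hdiss i)).
pose P i := s2val (PH i).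
pose V := qform (\mxdiag_i P i).
have Ppos i : posdefmx (P i) by exact: s2valP.
have Vpos : posdefmx (\mxdiag_i P i) by exact: posdefmx_mxdiag.
have step x1 x1' x2 x2' := @interconnection_dissipation _ _ _ _ _ _ _ Sigma
  phi M Sphi alpha Qm Sm Rm P x1 x1' x2 x2' HSphi Halpha
  (fun i => s2valP' (PH i)) HLMI.
split.
  exists (\mxdiag_i P i) => // _ [x1 [x2 [tx1 tx2 ->]]] _ k.
  by rewrite subr_le0; have [] := step _ _ _ _ (tx1 k) (tx2 k).
(* Well-posedness provides loop signals at every state, which turns the step relation into a total
   map [f]. *)
have next_ex x : exists x', interconnection Sigma phi M x x'.
  have [[[[u y] z] w] [loop _]] := Hwp x.
  exists (\mxcol_i lti_next (Sigma i) (submxcol x i) (submxcol u i)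
    (submxcol w i)).
  by exists u, y, z, w; split => // i; rewrite mxcolK.
pose f x := sval (cid (next_ex x)).
have fP x : interconnection Sigma phi M x (f x) := svalP (cid (next_ex x)).
(* Two successors of one state satisfy [V (a - b) <= V 0 = 0]. *)
have next_uniq x a b : interconnection Sigma phi M x a ->
    interconnection Sigma phi M x b -> a = b.
  move=> xa xb; apply/eqP; rewrite -subr_eq0; apply/eqP.
  apply: posdef_le0_eq0 Vpos _; have [+ _] := step _ _ _ _ xa xb.
  by rewrite subrr qform0.
have trajE x : trajectory (interconnection Sigma phi M) x ->
    x = (fun k => iter k f (x 0%N)).
  move=> tx; apply/funext; elim=> // k IH.
  by rewrite iterS -IH; exact: next_uniq (tx k) (fP _).
have [xs xsP] := Hfix; have fxs : f xs = xs by exact/xsP/fP.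
have f_le x y : V (f x - f y) <= V (x - y).
  by have [] := step _ _ _ _ (fP x) (fP y).
(* Constancy of [V] is the equality case at every step against the resting trajectory [xs].
   Detectability then sends each block of [d] to 0, so the constant [V (x - xs)] is also the limit
   0. *)
have inv x : (forall k, V (iter k f x - xs) = V (x - xs)) -> x = xs.
  move=> Vconst; pose d k := iter k f x - xs.
  have dE k i : submxcol (d k.+1) i = mxA (Sigma i) *m submxcol (d k) i /\
      mxCopt (Sigma i) *m submxcol (d k) i = 0.
    have xsxs : interconnection Sigma phi M xs xs by apply/xsP.
    have [_] := step _ _ _ _ (fP (iter k f x)) xsxs.
    by apply; rewrite -!/(V _) -iterS !Vconst.
  have d0 i : submxcol (d k) i @[k --> \oo] --> (0 : 'cV[R]_(n i)).
    by apply: (Hdet i) => k; have [] := dE k i.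
  have Vd0 : V (d k) @[k --> \oo] --> (0 : R).
    under eq_cvg do rewrite /V qform_mxdiag.
    have : \sum_i qform (P i) (submxcol (d k) i) @[k --> \oo] -->
        \sum_(i < N) (0 : R).
      apply: cvg_big => [|i _]; first exact: add_continuous.
      rewrite -(qform0 (P i)); apply: continuous_cvg; last exact: d0.
      exact: continuous_qform.
    by rewrite big1.
  have Vd : V (d k) @[k --> \oo] --> V (x - xs).
    by under eq_cvg do rewrite Vconst; exact: cvg_cst.
  apply/eqP; rewrite -subr_eq0; apply/eqP; apply: posdef_le0_eq0 Vpos _.
  by rewrite -/(V _) (cvg_unique _ Vd Vd0).
have fcvg := lasalle_qform Vpos f_le fxs inv.
move=> _ [x1 [x2 [/trajE-> /trajE-> ->]]].
(* Both trajectories are orbits of [f] and converge to the same point [xs]. *)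
by rewrite -(subrr xs); apply: cvgB; exact: fcvg.
Qed.
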